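(* Let $p\ge 3$ be a prime and let $r=\frac{a}{b}\in\mathbb{Q}$ be given by its Schneider continued fraction $$\frac{a}{b}=a_0+\cfrac{p^{\alpha_0}}{a_1+\cfrac{p^{\alpha_1}}{a_2+\cdots+\cfrac{p^{\alpha_{k-1}}}{a_k+\cfrac{p^{\alpha_k}}{p-1+\cfrac{p}{p-1+\cfrac{p}{\cdots}}}}}}$$ that is, $(a_j,\alpha_j)=(p-1,1)$ for all $j>k$. Assume that there is a pair $(\lambda,\alpha)\in\{1,\dots,p-1\}\times\mathbb{N}^*$ with $(\lambda,\alpha)\neq(p-1,1)$ such that $(a_i,\alpha_i)=(\lambda,\alpha)$ for all $0\le i\le k$. Let $T_1,T_2$ be the roots of the equation $T^2-\lambda T-p^{\alpha}=0$ and put $$\theta=\frac{(T_1-p^{\alpha})(a-bT_1)}{(T_2-p^{\alpha})(a-bT_2)}.$$ Then the length $k$ of the non-stationary part is $$k=\left[\frac{\ln|\theta|}{\ln\left|\frac{T_2}{T_1}\right|}\right]+1,$$ where $[\cdot]$ denotes the integer part.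
   Context: A Schneider continued fraction is determined by a sequence of pairs $((a_i,\alpha_i))_{i\in\mathbb{N}}$ with values in $\{1,\dots,p-1\}\times\mathbb{N}^*$, where $p$ is an odd prime and $\mathbb{N}^*=\{1,2,\dots\}$. Its $n$-th convergent is $$a_0+\cfrac{p^{\alpha_0}}{a_1+\cfrac{p^{\alpha_1}}{a_2+\cdots+\cfrac{p^{\alpha_{n-1}}}{a_n}}},$$ and a $p$-adic number is given by this continued fraction when it is the limit in $\mathbb{Q}_p$ of the convergents. The expansion of a rational number is called stationary if there is $k\ge 0$ such that $(a_j,\alpha_j)=(p-1,1)$ for all $j>k$; the number $k$ in the theorem is the one appearing in this condition, and the pairs before the constant tail $(p-1,1),(p-1,1),\dots$ form the non-stationary part.
   Formalization: With k the index such that (a_j,α_j)=(p-1,1) for all j>k, the formula is off by one (p=5, (λ,α)=(1,1), k=0, a/b=-4 gives 1); what is proved is the formula for the number of pairs before the constant tail, which is k+1. *)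

(* Defs.v *)
From HB Require Import structures.
From mathcomp Require Import all_boot all_order all_algebra.
From mathcomp Require Import reals exp.

Set Implicit Arguments.
Unset Strict Implicit.
Unset Printing Implicit Defensive.

Import Order.TTheory GRing.Theory Num.Theory.
Local Open Scope ring_scope.

(* Only meaningful for x != 0 (its value at 0 is the junk value 0). *)
Definition padic_val (p : nat) (x : rat) : int :=
  (logn p `|numq x|%N)%:Z - (logn p `|denq x|%N)%:Z.

Definition padic_abs (p : nat) (x : rat) : rat :=
  if x == 0 then 0 else (p%:R : rat) ^ (- padic_val p x).

(* Limit in Q_p of a sequence of rationals, for a rational limit. The absolute
   value of Q_p extends padic_abs p, so convergence to x in Q_p only involves
   the rational numbers u n - x. *)
Definition padic_cvg (p : nat) (u : nat -> rat) (x : rat) : Prop :=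
  forall eps : rat, 0 < eps ->
    exists N : nat, forall n : nat, (N <= n)%N -> padic_abs p (u n - x) < eps.

(* The sequence s stands for i |-> (a_i, alpha_i). *)
Definition schneider_seq (p : nat) (s : nat -> nat * nat) : Prop :=
  forall i : nat, [/\ (0 < (s i).1)%N, ((s i).1 < p)%N & (0 < (s i).2)%N].

(* a_i + p^alpha_i / (a_(i+1) + ... + p^alpha_(i+n-1) / a_(i+n)) *)
Fixpoint schneider_frac (p : nat) (s : nat -> nat * nat) (n i : nat) : rat :=
  if n is n'.+1 then
    (s i).1%:R + (p%:R ^+ (s i).2) / schneider_frac p s n' i.+1
  else (s i).1%:R.

Definition schneider_convergent (p : nat) (s : nat -> nat * nat) (n : nat) :
  rat := schneider_frac p s n 0.

Definition schneider_expansion (p : nat) (s : nat -> nat * nat) (r : rat) :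
  Prop := schneider_seq p s /\ padic_cvg p (schneider_convergent p s) r.

(* The pairs of index at least l are all (p - 1, 1). *)
Definition stationary_from (p : nat) (s : nat -> nat * nat) (l : nat) : Prop :=
  forall j : nat, (l <= j)%N -> s j = (p.-1, 1%N).

(* The non-stationary part consists of the pairs s 0, ..., s (l - 1) preceding
   the maximal constant tail; l is the number of these pairs. Indices start at
   0, so if the last pair different from (p - 1, 1) is s k, then l = k + 1. *)
Definition nonstationary_length (p : nat) (s : nat -> nat * nat) (l : nat) :
  Prop :=
  stationary_from p s l /\
  forall m : nat, stationary_from p s m -> (l <= m)%N.

(* Main.v *)
Require Import Defs.
From HB Require Import structures.
From mathcomp Require Import all_boot all_order all_algebra.
From mathcomp Require Import reals exp.
From mathcomp Require Import zify ring lra.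

Set Implicit Arguments.
Unset Strict Implicit.
Unset Printing Implicit Defensive.

Import Order.TTheory GRing.Theory Num.Theory.
Local Open Scope ring_scope.

(* The tail p-1 + p/(p-1 + ...) has the value x with x = p-1 + p/x that is a
   p-adic unit, namely x = -1. All complete quotients are units and
   u |-> c + p^e/u contracts p-adic distances between units, so a/b is the image
   of -1 under k+1 iterations of u |-> lambda + p^alpha/u. This homography has
   fixed points T1, T2 and multiplies (u - T1)/(u - T2) by T2/T1, whence
   (a - b T1)/(a - b T2) = (T2/T1)^(k+1) (1 + T1)/(1 + T2). Finally
   (T - p^alpha)(1 + T) = (lambda + 1 - p^alpha) T for both roots, so that
   theta = (T2/T1)^k. *)

(** * p-adic divisibility and units among the rationals *)

Section PadicDivisibility.

Variable p : nat.
Hypothesis p_prime : prime p.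

(** Membership in p^N Z_(p), written with an arbitrary denominator prime to [p]: fractions need not
    be reduced, and 0 is no special case. *)
Definition padic_dvd (N : nat) (x : rat) : Prop :=
  exists m n : int, ~~ (p %| n)%Z /\ x * n%:~R = p%:R ^+ N * m%:~R.

Definition padic_unit (x : rat) : Prop :=
  exists m n : int, [/\ ~~ (p %| m)%Z, ~~ (p %| n)%Z & x * n%:~R = m%:~R].

Let prime_dvdzM (m n : int) : (p %| m * n)%Z = (p %| m)%Z || (p %| n)%Z.
Proof. by rewrite !dvdzE abszM /= Euclid_dvdM. Qed.

Let pndvd_small (c : nat) : (0 < c < p)%N -> ~~ (p %| c%:Z)%Z.
Proof.
move=> /andP[c0 cp]; rewrite dvdzE /=.
by apply/negP => /(dvdn_leq c0); rewrite leqNgt cp.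
Qed.

Let pndvd1 : ~~ (p %| 1)%Z.
Proof. by rewrite dvdzE /= Euclid_dvd1. Qed.

Let pndvd_neq0 (n : int) : ~~ (p %| n)%Z -> (n%:~R : rat) != 0.
Proof. by rewrite intr_eq0; apply: contra => /eqP->; rewrite dvdz0. Qed.

Lemma padic_unit_neq0 x : padic_unit x -> x != 0.
Proof.
move=> [m [n [pm _ xE]]]; apply: contraTneq (pndvd_neq0 pm) => x0.
by rewrite -xE x0 mul0r eqxx.
Qed.

Lemma padic_unitN1 : padic_unit (-1).
Proof. by exists (-1), 1; split; rewrite ?rpredN // rmorphN mulr1. Qed.

Lemma padic_unit_dvd x : padic_unit x -> padic_dvd 0 x.
Proof. by move=> [m [n [_ pn xE]]]; exists m, n; rewrite expr0 mul1r. Qed.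

Lemma padic_unit_nat (c : nat) : (0 < c < p)%N -> padic_unit c%:R.
Proof.
move=> cp; exists c%:Z, 1; split; rewrite ?(pndvd_small cp) //; exact: mulr1.
Qed.

(** For x = m/n the new value is (c m + p^e n)/m, whose numerator is congruent to c m modulo [p]. *)
Lemma padic_unit_step (c e : nat) x : (0 < c < p)%N -> (0 < e)%N ->
  padic_unit x -> padic_unit (c%:R + p%:R ^+ e / x).
Proof.
move=> cp e0 ux; have x0 := padic_unit_neq0 ux.
case: ux => m [n [pm pn xE]].
exists (c%:Z * m + (p ^ e)%:Z * n), m; split=> //.
  rewrite rpredDr; first by rewrite prime_dvdzM negb_or pndvd_small.
  by rewrite -(prednK e0) expnS PoszM -mulrA dvdz_mulr.
rewrite rmorphD !rmorphM /= -!pmulrn natrX -xE.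
by field.
Qed.

Lemma padic_dvdB N x y :
  padic_dvd N x -> padic_dvd N y -> padic_dvd N (x - y).
Proof.
move=> [m [n [pn xE]]] [m' [n' [pn' yE]]].
exists (m * n' - m' * n), (n * n'); split.
  by rewrite prime_dvdzM negb_or pn.
by rewrite rmorphB !rmorphM /= mulrBr !mulrA -xE -yE; ring.
Qed.

(** The difference equals - p^e (x - y)/(x y): dividing by units costs nothing, and p^e contributes
    at least one factor [p]. *)
Lemma padic_dvd_step N (c e : nat) x y : (0 < e)%N ->
  padic_unit x -> padic_unit y -> padic_dvd N (x - y) ->
  padic_dvd N.+1 ((c%:R + p%:R ^+ e / x) - (c%:R + p%:R ^+ e / y)).
Proof.
move=> e0 ux uy; have x0 := padic_unit_neq0 ux; have y0 := padic_unit_neq0 uy.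
case: ux uy => m [n [pm pn xE]] [m' [n' [pm' pn' yE]]] [d [z [pz dE]]].
exists (- ((p ^ e.-1)%:Z * d * n * n')), (m * m' * z).
split; first by rewrite !prime_dvdzM !negb_or pm pm'.
rewrite rmorphN !rmorphM /= -pmulrn natrX -xE -yE.
rewrite -{1 2}(prednK e0) !exprS.
transitivity (- (p%:R * p%:R ^+ e.-1 * n%:~R * n'%:~R * ((x - y) * z%:~R))).
  by field; rewrite x0 y0.
by rewrite dE; ring.
Qed.

(** A single exponent suffices, the absolute value N of the numerator: p^N would divide N, yet N <
    p^N. *)
Lemma padic_dvd_eq0 x : (forall N, padic_dvd N x) -> x = 0.
Proof.
move=> dvdx; apply/eqP; rewrite -numq_eq0; apply/negPn/negP => num0.
have [m [n [pn xE]]] := dvdx `|numq x|%N.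
have E : numq x * n = (p ^ `|numq x|)%N%:Z * m * denq x.
  apply: (@intr_inj rat); rewrite !rmorphM /= -pmulrn natrX -xE.
  by rewrite -{2}(divq_num_den x) mulrAC divfK ?intr_eq0 ?denq_neq0.
have : (p ^ `|numq x| %| `|numq x|)%N.
  rewrite -(@Gauss_dvdl _ _ `|n|%N); last first.
    by rewrite coprimeXl // prime_coprime // -dvdzE.
  by rewrite -abszM E -mulrA abszM dvdn_mulr.
move/dvdn_leq; rewrite absz_gt0 num0 => /(_ isT).
by rewrite leqNgt ltn_expl ?prime_gt1.
Qed.

Lemma padic_abs_dvd N x : padic_abs p x < p%:R ^- N -> padic_dvd N x.
Proof.
have p1 : (1 : rat) < p%:R by rewrite ltr1n prime_gt1.
rewrite /padic_abs; case: eqP => [-> _|/eqP x0].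
  by exists 0, 1; split; rewrite // mul0r mulr0.
rewrite exprnN (ltr_eXz2l p1) ltrN2 /padic_val => lt_val.
have lt_log : (N + logn p `|denq x| < logn p `|numq x|)%N by lia.
have num_gt0 : (0 < `|numq x|)%N by rewrite absz_gt0 numq_eq0.
have /dvdzP[m numE] : ((p ^ N)%N%:Z %| numq x)%Z.
  by rewrite dvdzE /= pfactor_dvdn //; lia.
exists m, (denq x); split; last first.
  rewrite -{1}(divq_num_den x) divfK ?intr_eq0 ?denq_neq0 //.
  by rewrite {1}numE rmorphM /= -pmulrn natrX mulrC.
(* The numerator has positive valuation, so lowest terms keep [p] out of the denominator. *)
apply/negP; rewrite dvdzE /= => pden.
have pnum : (p %| `|numq x|)%N by rewrite -(expn1 p) pfactor_dvdn //; lia.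
have := coprime_num_den x; rewrite /coprime => /eqP g1.
by have := dvdn_gcd p `|numq x| `|denq x|; rewrite pnum pden g1 Euclid_dvd1.
Qed.

(** * Values of Schneider continued fractions *)

Lemma schneider_frac_unit s n i :
  schneider_seq p s -> padic_unit (schneider_frac p s n i).
Proof.
move=> sP; elim: n i => [|n IHn] i /=; case: (sP i) => c0 cp e0.
  by apply: padic_unit_nat; rewrite c0.
by apply: padic_unit_step; rewrite ?c0.
Qed.

(** At the innermost level both terms are units, so their difference is p-integral; each of the n
    levels above gains a factor [p]. *)
Lemma schneider_frac_dvd s (E : nat -> rat) n i : schneider_seq p s ->
  (forall j, padic_unit (E j)) ->
  (forall j, E j = (s j).1%:R + p%:R ^+ (s j).2 / E j.+1) ->
  padic_dvd n (schneider_frac p s n i - E i).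
Proof.
move=> sP uE eE; elim: n i => [|n IHn] i.
  by apply: padic_dvdB; apply: padic_unit_dvd => //; apply: schneider_frac_unit.
rewrite eE /=; case: (sP i) => _ _ e0.
by apply: padic_dvd_step => //; apply: schneider_frac_unit.
Qed.

(* E plays the role of the sequence of complete quotients. *)
Lemma schneider_expansion_unique s (E : nat -> rat) r :
  schneider_expansion p s r ->
  (forall j, padic_unit (E j)) ->
  (forall j, E j = (s j).1%:R + p%:R ^+ (s j).2 / E j.+1) ->
  r = E 0%N.
Proof.
move=> [sP cvg_s] uE eE; apply/eqP; rewrite -subr_eq0; apply/eqP.
apply: padic_dvd_eq0 => N.
have eps0 : (0 : rat) < p%:R ^- N.
  by rewrite invr_gt0 exprn_gt0 // ltr0n prime_gt0.
have [M cvgM] := cvg_s _ eps0.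
(* [n] must reach [M] for closeness to [r], and [N] for closeness to [E 0]. *)
pose n := maxn M N.
have -> : r - E 0%N =
    (schneider_frac p s n 0 - E 0%N) - (schneider_frac p s n 0 - r).
  by ring.
apply: padic_dvdB; last by apply: padic_abs_dvd; apply: cvgM; apply: leq_maxl.
have [m [z [pz zE]]] := schneider_frac_dvd n 0 sP uE eE.
exists ((p ^ (n - N))%N%:Z * m), z; split=> //.
by rewrite zE rmorphM /= -pmulrn natrX mulrA -exprD subnKC ?leq_maxr.
Qed.

End PadicDivisibility.

(** * Length of the non-stationary part, roots and homography *)

Lemma nonstationary_length_last p s k : stationary_from p s k.+1 ->
  s k <> (p.-1, 1%N) -> nonstationary_length p s k.+1.
Proof.
move=> tail sk; split=> // m tail_m; rewrite ltnNge; apply/negP => lemk.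
exact/sk/tail_m.
Qed.

(** The hypothesis only describes the set of roots, so t1 = t2 has to be excluded. The conjugate l -
    t1 is a root; if it were t1, then t1^2 = -q < 0. *)
Lemma quadratic_roots_sum_prod (R : realFieldType) (l q t1 t2 : R) : 0 < q ->
  (forall t, t ^+ 2 - l * t - q = 0 <-> t = t1 \/ t = t2) ->
  t1 + t2 = l /\ t1 * t2 = - q.
Proof.
move=> q0 roots.
have r1 : t1 ^+ 2 - l * t1 - q = 0 by apply/roots; left.
have /roots[e|e] : (l - t1) ^+ 2 - l * (l - t1) - q = 0 by rewrite -r1; ring.
  have t1_sq := sqr_ge0 t1; have lE : l = t1 + t1 by lra.
  by move: r1; rewrite lE; nra.
split; first by rewrite -e; ring.
have -> : q = t1 ^+ 2 - l * t1 by apply/eqP; rewrite eq_sym -subr_eq0 r1.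
by rewrite -e; ring.
Qed.

(** The conjunct [x j != t2] is carried through the induction to keep the denominators nonzero. *)
Lemma homography_iter (F : fieldType) (t1 t2 : F) (x : nat -> F) :
  t1 != 0 -> (forall j, x j != 0) -> x 0%N != t2 ->
  (forall j, x j.+1 = t1 + t2 - t1 * t2 / x j) ->
  forall j, x j != t2 /\
    (x j - t1) / (x j - t2) = (t2 / t1) ^+ j * ((x 0%N - t1) / (x 0%N - t2)).
Proof.
move=> t10 x0 x0t2 xS; elim=> [|j [xjt2 IHj]]; first by rewrite expr0 mul1r.
have stepr : x j.+1 - t2 = t1 * (x j - t2) / x j by rewrite xS; field.
have stepl : x j.+1 - t1 = t2 * (x j - t1) / x j by rewrite xS; field.
have d0 : x j - t2 != 0 by rewrite subr_eq0.
split; first by rewrite -subr_eq0 stepr !mulf_neq0 ?invr_eq0.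
rewrite exprS -mulrA -IHj stepl stepr.
by field; rewrite d0 t10 x0.
Qed.

Theorem theorem3p2 (R : realType) (p : nat) (a b : int)
    (s : nat -> nat * nat) (k lambda alpha : nat) (T1 T2 : R)
    (p_prime : prime p) (p_ge3 : (3 <= p)%N) (b_neq0 : b != 0)
    (s_expansion : schneider_expansion p s (a%:~R / b%:~R))
    (s_tail : forall j : nat, (k < j)%N -> s j = (p.-1, 1%N))
    (lambda_range : (0 < lambda < p)%N) (alpha_gt0 : (0 < alpha)%N)
    (nonstationary : (lambda, alpha) <> (p.-1, 1%N))
    (s_head : forall i : nat, (i <= k)%N -> s i = (lambda, alpha))
    (T_roots : forall T : R,
      T ^+ 2 - lambda%:R * T - p%:R ^+ alpha = 0 <-> T = T1 \/ T = T2) :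
  let theta : R :=
    ((T1 - p%:R ^+ alpha) * (a%:~R - b%:~R * T1)) /
    ((T2 - p%:R ^+ alpha) * (a%:~R - b%:~R * T2)) in
  exists2 l : nat, nonstationary_length p s l &
    l%:Z = Num.floor (ln `|theta| / ln `|T2 / T1|) + 1.
Proof.
(* Indices 0 to k make k + 1 pairs, whereas [theta] will be the k-th power of T2/T1; this is the + 1
   of the formula. *)
move=> theta; exists k.+1.
  by apply: nonstationary_length_last => //; rewrite s_head.
set q : R := p%:R ^+ alpha in theta T_roots *.
have q0 : 0 < q by rewrite exprn_gt0 // ltr0n prime_gt0.
have [sumT prodT] := quadratic_roots_sum_prod q0 T_roots.
have T12_neq0 : T1 * T2 != 0 by rewrite prodT oppr_eq0 gt_eqF.
have [T10 T20] : T1 != 0 /\ T2 != 0.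
  by move: T12_neq0; rewrite mulf_eq0 negb_or => /andP.
(* [X j] is the complete quotient j levels above the constant tail. Being a p-adic unit, it is
   nonzero, hence so is its image in [R]. *)
pose X j : rat := iter j (fun x => lambda%:R + p%:R ^+ alpha / x) (-1).
have uX j : padic_unit p (X j).
  by elim: j => [|j IHj] /=; [apply: padic_unitN1 | apply: padic_unit_step].
have rE : a%:~R / b%:~R = X k.+1.
  (* Truncated subtraction makes [E i] equal to -1 for every i > k, as the tail requires. *)
  pose E i := X (k.+1 - i)%N; rewrite -[X k.+1]/(E 0%N).
  apply: (schneider_expansion_unique p_prime s_expansion); rewrite /E.
    by move=> j; apply: uX.
  move=> j; case: (leqP j k) => jk; first by rewrite s_head //= subSS subSn.
  have -> : (k.+1 - j = 0)%N by lia.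
  have -> : (k.+1 - j.+1 = 0)%N by lia.
  by rewrite s_tail //= expr1 invrN1 mulrN1 -subn1 natrB ?prime_gt0 //; ring.
pose x j : R := ratr (X j).
have x_neq0 j : x j != 0 by rewrite fmorph_eq0 (padic_unit_neq0 (uX j)).
have xS j : x j.+1 = T1 + T2 - T1 * T2 / x j.
  rewrite sumT prodT mulNr opprK /x /= rmorphD fmorph_div rmorphXn /=.
  by rewrite !ratr_nat.
have x0 : x 0%N = -1 by rewrite /x /= rmorphN1.
pose c : R := lambda%:R + 1 - q.
have c0 : c != 0.
  (* If lambda + 1 = p^alpha, then lambda < p forces alpha = 1 and lambda = p - 1, the excluded
     pair. *)
  rewrite /c /q -natrX natr1 subr_eq0 eqr_nat; apply/eqP => lamE.
  apply: nonstationary; case/andP: lambda_range => _ lamp.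
  have alpha1 : alpha = 1%N.
    apply/eqP; rewrite eqn_leq alpha_gt0 andbT.
    by rewrite -(leq_exp2l _ _ (prime_gt1 p_prime)) expn1 -lamE.
  by rewrite alpha1 expn1 in lamE *; rewrite -lamE.
have facT T : T = T1 \/ T = T2 -> (T - q) * (1 + T) = c * T.
  by move=> /T_roots TE; apply/eqP; rewrite -subr_eq0 -TE /c; apply/eqP; ring.
have fac1 := facT T1 (or_introl erefl); have fac2 := facT T2 (or_intror erefl).
(* The factorization shows that no factor of [theta] degenerates: neither root equals [q], and the
   starting point -1 is not a fixed point. *)
have : (T1 - q) * (1 + T1) != 0 by rewrite fac1 mulf_neq0.
rewrite mulf_eq0 negb_or => /andP[T1q T1p].
have : (T2 - q) * (1 + T2) != 0 by rewrite fac2 mulf_neq0.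
rewrite mulf_eq0 negb_or => /andP[T2q T2p].
have x0T2 : x 0%N != T2 by rewrite x0 eq_sym -subr_eq0 opprK addrC.
have [xT2 xE] := homography_iter T10 x_neq0 x0T2 xS k.+1.
have bR : (b%:~R : R) != 0 by rewrite intr_eq0.
have aE : a%:~R = b%:~R * x k.+1.
  by rewrite /x -rE fmorph_div /= !ratr_int; field.
have thetaE : theta = (T2 / T1) ^+ k.
  have d0 : x k.+1 - T2 != 0 by rewrite subr_eq0.
  clearbody x.
  transitivity ((T1 - q) / (T2 - q) * ((x k.+1 - T1) / (x k.+1 - T2))).
    rewrite /theta aE; field.
    by rewrite d0 T2q -mulrBr mulf_neq0.
  rewrite xE x0 exprS.
  transitivity (((T1 - q) * (1 + T1)) / ((T2 - q) * (1 + T2)) * (T2 / T1) *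
    (T2 / T1) ^+ k).
    by field; rewrite T10 T2p T2q -opprD oppr_eq0.
  rewrite fac1 fac2; field.
  by rewrite T10 T20 c0.
(* Equal absolute values would mean T1 = T2, whose square would be -q < 0, or T1 = -T2, which gives
   lambda = 0. *)
have lnT : ln `|T2 / T1| != 0.
  rewrite ln_eq0 ?normr_gt0 ?mulf_neq0 ?invr_eq0 //.
  rewrite normf_div; apply/eqP => /divr1_eq /eqP.
  rewrite eqr_norm2 => /orP[/eqP T12|/eqP T12]; last first.
    by move: lambda_range; rewrite -(ltr0n R) -sumT T12 subrr ltxx.
  by have := sqr_ge0 T1; rewrite expr2 -{2}T12 prodT oppr_ge0 leNgt q0.
(* The quotient of logarithms is exactly the integer k, so the floor loses nothing. *)
rewrite thetaE normrX lnXn ?normr_gt0 ?mulf_neq0 ?invr_eq0 //.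
by rewrite -mulr_natl mulfK // [k%:R]pmulrn intrKfloor -addn1 PoszD.
Qed.
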